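(* Let $X_{\Omega_1}\subset\mathbb{R}^{2n}$ and $X_{\Omega_2}\subset\mathbb{R}^{2m}$ be convex toric domains associated with bounded nonempty relatively open subsets $\Omega_1\subset\mathbb{R}^{n}_{\ge 0}$ and $\Omega_2\subset\mathbb{R}^{m}_{\ge 0}$, respectively. Then $X_{\Omega_1}\times X_{\Omega_2}$ is equal to the convex toric domain $X_{\Omega_1\times\Omega_2}$, and for any normalized symplectic capacity $c$ on $\mathbb{R}^{2n+2m}$ (and any normalized symplectic capacities on $\mathbb{R}^{2n}$ and on $\mathbb{R}^{2m}$, also denoted by $c$) there holds $$c(X_{\Omega_1}\times X_{\Omega_2})=\min\{c(X_{\Omega_1}),c(X_{\Omega_2})\}.$$ The same conclusion holds true after $\Omega_1$ and $\Omega_2$ are replaced by their closures $\overline{\Omega_1}$ and $\overline{\Omega_2}$, respectively.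
   Context: $\omega_0=\sum_j dx_j\wedge dy_j$ is the standard symplectic structure on $\mathbb{R}^{2k}=\mathbb{C}^k$ (with $z_j=x_j+iy_j$). A symplectic capacity on $\mathbb{R}^{2k}$ is a map $c$ assigning to each subset $U\subset\mathbb{R}^{2k}$ a number $c(U)\in[0,\infty]$ such that: (Monotonicity) $c(U)\le c(V)$ for $U\subset V\subset\mathbb{R}^{2k}$; (Conformality) $c(\psi(U))=|\alpha|c(U)$ for every diffeomorphism $\psi$ of $\mathbb{R}^{2k}$ with $\psi^*\omega_0=\alpha\omega_0$, $\alpha\neq 0$; (Nontriviality) $0<c(B^{2k}(1))$ and $c(Z^{2k}(1))<\infty$. Here $B^{2k}(r)=\{z\in\mathbb{R}^{2k}\mid |z|^2<r^2\}$ and $Z^{2k}(R)=B^2(R)\times\mathbb{R}^{2k-2}$, where the factor $B^2(R)$ is the disc in the $z_1$-plane. It is normalized if $c(B^{2k}(1))=c(Z^{2k}(1))=\pi$. $\mathbb{R}^k_{\ge 0}$ is the set of $x\in\mathbb{R}^k$ with all $x_i\ge0$; $\mu:\mathbb{C}^k\to\mathbb{R}^k$, $\mu(z_1,\dots,z_k)=(\pi|z_1|^2,\dots,\pi|z_k|^2)$. For a nonempty relatively open $\Omega\subset\mathbb{R}^k_{\ge0}$, $X_\Omega=\mu^{-1}(\Omega)$ and $X_{\overline\Omega}=\mu^{-1}(\overline\Omega)$, with $\overline\Omega$ the closure of $\Omega$. They are called convex toric domains if $\Omega$ is bounded and $\widehat\Omega=\{x\in\mathbb{R}^k\mid(|x_1|,\dots,|x_k|)\in\Omega\}$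 is convex in $\mathbb{R}^k$. We identify $\mathbb{C}^n\times\mathbb{C}^m$ with $\mathbb{C}^{n+m}$. *)

(* Defs.v *)
From HB Require Import structures.
From mathcomp Require Import all_boot all_order all_algebra.
From mathcomp Require Import all_classical all_reals all_analysis.

Set Implicit Arguments.
Unset Strict Implicit.
Unset Printing Implicit Defensive.

Import Order.TTheory GRing.Theory Num.Theory.
Import numFieldNormedType.Exports.

Local Open Scope classical_set_scope.
Local Open Scope ring_scope.

(* $\mathbb{R}^{2k} = \mathbb{C}^k$: row j of z is (x_j, y_j), the real and
   imaginary parts of z_j.  The canonical norm of this type is the sup norm,
   so the Euclidean norm is written out in [sqnorm]; topology and derivatives
   do not depend on the choice. *)
Notation Cspace R k := 'M[R]_(k, 2).

Section Symplectic.
Context {R : realType} {k : nat}.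
Implicit Types (z u v : Cspace R k) (psi : Cspace R k -> Cspace R k).

Definition sqmod z (j : 'I_k) : R := z j 0 ^+ 2 + z j 1 ^+ 2.

Definition sqnorm z : R := \sum_(j < k) sqmod z j.

Definition omega0 u v : R := \sum_(j < k) (u j 0 * v j 1 - u j 1 * v j 0).

(* $\psi^*\omega_0 = \alpha\omega_0$ *)
Definition pullback_omega0 psi (alpha : R) : Prop :=
  forall z u v, omega0 ('d psi z u) ('d psi z v) = alpha * omega0 u v.

End Symplectic.

(* In finite dimension this is the usual class $C^r$: all iterated directional
   derivatives up to order r exist and are continuous. *)
Fixpoint class_C (R : realType) (V W : normedModType R) (r : nat)
    (f : V -> W) : Prop :=
  if r is r'.+1 then
    (forall x, differentiable f x) /\
    (forall v, class_C r' (fun x => 'D_v f x))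
  else continuous f.

Definition smooth (R : realType) (V W : normedModType R) (f : V -> W) : Prop :=
  forall r, class_C r f.

Definition diffeomorphism (R : realType) (V W : normedModType R)
    (f : V -> W) : Prop :=
  smooth f /\ exists g : W -> V, [/\ smooth g, cancel f g & cancel g f].

Definition ball2 (R : realType) (k : nat) (r : R) : set (Cspace R k) :=
  [set z | sqnorm z < r ^+ 2].

(* The condition bears only on the first complex coordinate, of index 0;
   meaningful for 0 < k. *)
Definition cylinder (R : realType) (k : nat) (r : R) : set (Cspace R k) :=
  [set z | forall j : 'I_k, nat_of_ord j = 0%N -> sqmod z j < r ^+ 2].

Arguments ball2 {R} k r.
Arguments cylinder {R} k r.

Record symplectic_capacity (R : realType) (k : nat)
    (c : set (Cspace R k) -> \bar R) : Prop := SymplecticCapacity {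
  capacity_ge0 : forall U, (0 <= c U)%E ;
  capacity_monotone : forall U V, U `<=` V -> (c U <= c V)%E ;
  capacity_conformal : forall (psi : Cspace R k -> Cspace R k) (alpha : R),
    diffeomorphism psi -> alpha != 0 -> pullback_omega0 psi alpha ->
    forall U, c (psi @` U) = (`|alpha|%:E * c U)%E ;
  capacity_ball_gt0 : (0 < c (ball2 k 1))%E ;
  capacity_cylinder_lty : (c (cylinder k 1) < +oo)%E
}.

Record normalized_capacity (R : realType) (k : nat)
    (c : set (Cspace R k) -> \bar R) : Prop := NormalizedCapacity {
  normalized_capacity_symplectic : symplectic_capacity c ;
  normalized_capacity_ball : c (ball2 k 1) = (pi : R)%:E ;
  normalized_capacity_cylinder : c (cylinder k 1) = (pi : R)%:E
}.

Section Toric.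
Context {R : realType} {k : nat}.
Implicit Types Omega : set 'rV[R]_k.

Definition orthant : set 'rV[R]_k := [set x | forall j, 0 <= x 0 j].

Definition moment (z : Cspace R k) : 'rV[R]_k := \row_j (pi * sqmod z j).

(* $X_\Omega$; with [closure Omega] in place of [Omega] it is
   $X_{\overline\Omega}$ *)
Definition toric_domain Omega : set (Cspace R k) := moment @^-1` Omega.

Definition relatively_open Omega : Prop :=
  exists2 O : set 'rV[R]_k, open O & Omega = O `&` orthant.

Definition hat Omega : set 'rV[R]_k :=
  [set x | Omega (\row_j `|x 0 j|)].

(* The standing assumptions on $\Omega$ under which $X_\Omega$ and
   $X_{\overline\Omega}$ are called convex toric domains. *)
Record convex_toric Omega : Prop := ConvexToric {
  convex_toric_nonempty : Omega !=set0 ;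
  convex_toric_open : relatively_open Omega ;
  convex_toric_bounded : bounded_set Omega ;
  convex_toric_convex : convex_set (hat Omega)
}.

End Toric.

(* The identifications $\mathbb{R}^n\times\mathbb{R}^m = \mathbb{R}^{n+m}$ and
   $\mathbb{C}^n\times\mathbb{C}^m = \mathbb{C}^{n+m}$, applied to products. *)
Definition prodR (R : realType) (n m : nat)
    (A : set 'rV[R]_n) (B : set 'rV[R]_m) : set 'rV[R]_(n + m) :=
  [set row_mx a b | a in A & b in B].

Definition prodC (R : realType) (n m : nat)
    (A : set (Cspace R n)) (B : set (Cspace R m)) : set (Cspace R (n + m)) :=
  [set col_mx a b | a in A & b in B].

(* Main.v *)
Require Import Defs.
From mathcomp Require Import all_boot all_order all_algebra.
From mathcomp Require Import all_classical all_reals all_analysis.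
From mathcomp Require Import perm ring lra.
Set Implicit Arguments.
Unset Strict Implicit.

Import Order.TTheory GRing.Theory Num.Theory.
Import numFieldNormedType.Exports.
Local Open Scope classical_set_scope.
Local Open Scope ring_scope.

(** The capacity of a convex toric domain is forced by monotonicity, which puts
    it between the capacities of a ball and of a cylinder.  Let [A] be a convex
    subset of the orthant that contains the origin and, with each point, its
    projections to the coordinate axes, and let [L] be the supremum of the
    [s >= 0] such that all the points [s e_1, ..., s e_k] lie in [A].  If all
    [s e_j] lie in [A], then so does the simplex they span with the origin, so
    [toric_domain A] contains the open ball [pi |z|^2 < s].  If some [s e_j]
    does not lie in [A], then no point of [A] has j-th coordinate at least [s],
    because it would project to a point [t e_j] of [A] with [t >= s]; hence
    [toric_domain A] is contained in the cylinder [pi |z_j|^2 < s].  The maps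
    [z |-> r (z with its coordinates 0 and j exchanged)] are diffeomorphisms
    that multiply the symplectic form by [r ^ 2], so for [s > 0] every
    normalized capacity takes the value [s] on both the ball and the cylinder;
    consequently it takes the value [L] on [toric_domain A].

    Every coordinate axis of a product [A x B] lies in one of the two factors,
    so an [s] is admissible for [A x B] if and only if it is admissible for
    both [A] and [B]: thus the [L] of [A x B] is the minimum of the two others.
    The hypothesis on [A], isolated in [axis_convex], follows from the convexity
    of a nonempty [hat A] by averaging points with their reflections, and it
    passes to closures; so the open and the closed case have the same proof,
    [capacity_prodC]. *)

(** * Continuity and closures *)

Lemma mx_continuous (T : topologicalType) (R : realType) (m n : nat)
    (f : T -> 'M[R]_(m, n)) :
  (forall i j, continuous (fun x => f x i j)) -> continuous f.
Proof.
move=> fc x A [P fxP PA].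
have : \forall y \near x, forall i j, P i j (f y i j).
  by apply: filter_forall => i; apply: filter_forall => j; exact/fc/fxP.
by apply: filterS => y Py; exact: PA.
Qed.

(** The hypothesis asks [f] to send [A] only into the closure of [B], so that
    for maps of two variables the lemma applies to one variable after the
    other. *)
Lemma closure_image (S T : topologicalType) (f : S -> T)
    (A : set S) (B : set T) (x : S) :
  continuous f -> (forall y, A y -> closure B (f y)) ->
  closure A x -> closure B (f x).
Proof.
move=> fc AB Ax; apply: closed_closure => U xU.
have [y [Ay fyU]] := Ax _ (fc x U xU).
by exists (f y); split => //; exact: AB.
Qed.

(** * Conformally symplectic linear maps *)

Lemma class_C_cst (R : realType) (V W : normedModType R) (r : nat) (a : W) :
  class_C r (fun _ : V => a).
Proof.
elim: r a => [|r IHr] a /=; first exact: cst_continuous.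
split=> [x|v]; first exact: differentiable_cst.
have -> : (fun x => 'D_v (fun _ : V => a) x) = (fun _ => 0).
  by apply/funext => x; exact: derive_cst.
exact: IHr.
Qed.

(** A directional derivative of a continuous linear map does not depend on the
    base point. *)
Lemma linear_smooth (R : realType) (V W : normedModType R)
    (f : {linear V -> W}) : continuous f -> smooth f.
Proof.
move=> fc [|r] //=; split=> [x|v]; first exact: linear_differentiable.
have -> : (fun x => 'D_v f x) = (fun _ => f v).
  apply/funext => x; rewrite deriveE ?diff_lin//.
  exact: linear_differentiable.
exact: class_C_cst.
Qed.

Lemma scale_xrow_continuous (R : realType) (k : nat) (i j : 'I_k) (r : R) :
  continuous (r \*: xrow i j : Cspace R k -> Cspace R k).
Proof.
apply: mx_continuous => a b.
rewrite (_ : (fun x => _) = (fun x : Cspace R k => r * x (tperm i j a) b)).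
  move=> x; apply: (continuous_comp (g := *%R r)).
    exact: coord_continuous.
  exact: mulrl_continuous.
by apply/funext => x; rewrite !mxE.
Qed.

Lemma scale_xrowK (R : realType) (k : nat) (i j : 'I_k) (r : R) :
  r != 0 -> cancel (r^-1 \*: xrow i j : Cspace R k -> Cspace R k)
                   (r \*: xrow i j).
Proof.
by move=> r0 z; apply/matrixP => a b; rewrite !mxE tpermK mulVKf.
Qed.

Lemma scale_xrow_diffeomorphism (R : realType) (k : nat) (i j : 'I_k) (r : R) :
  r != 0 -> diffeomorphism (r \*: xrow i j : Cspace R k -> Cspace R k).
Proof.
move=> r0; split; first by apply: linear_smooth; exact: scale_xrow_continuous.
exists (r^-1 \*: xrow i j); split.
- by apply: linear_smooth; exact: scale_xrow_continuous.
- by have := @scale_xrowK R k i j r^-1; rewrite invrK invr_eq0; exact.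
- exact: scale_xrowK.
Qed.

Lemma scale_xrow_omega0 (R : realType) (k : nat) (i j : 'I_k) (r : R) :
  pullback_omega0 (r \*: xrow i j : Cspace R k -> Cspace R k) (r ^+ 2).
Proof.
move=> z u v; rewrite diff_lin; last exact: scale_xrow_continuous.
rewrite /omega0 mulr_sumr [RHS](reindex_inj (@perm_inj _ (tperm i j))) /=.
by apply: eq_bigr => a _; rewrite !mxE; ring.
Qed.

Lemma sqmod_scale_xrow (R : realType) (k : nat) (i j a : 'I_k) (r : R)
    (z : Cspace R k) :
  sqmod ((r \*: xrow i j) z) a = r ^+ 2 * sqmod z (tperm i j a).
Proof. by rewrite /sqmod !mxE; ring. Qed.

Lemma capacity_scale_xrow (R : realType) (k : nat)
    (c : set (Cspace R k) -> \bar R) (i j : 'I_k) (r : R)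
    (U : set (Cspace R k)) :
  symplectic_capacity c -> r != 0 ->
  c ((r \*: xrow i j) @` U) = ((r ^+ 2)%:E * c U)%E.
Proof.
move=> hc r0; rewrite (capacity_conformal hc (alpha := r ^+ 2)).
- by rewrite ger0_norm// sqr_ge0.
- exact: scale_xrow_diffeomorphism.
- by rewrite expf_neq0.
- exact: scale_xrow_omega0.
Qed.

(** The ball [pi |z|^2 < s] is the image of the unit ball under the dilation by
    [sqrt (s / pi)], which multiplies capacities by [s / pi]. *)
Lemma ball_capacity_ge (R : realType) (k : nat) (hk : (0 < k)%N)
    (c : set (Cspace R k) -> \bar R) (s : R) (U : set (Cspace R k)) :
  normalized_capacity c -> 0 < s ->
  (forall z, pi * sqnorm z < s -> U z) -> (s%:E <= c U)%E.
Proof.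
move=> hc s0 HU; have hs := normalized_capacity_symplectic hc.
have pi0 : 0 < pi :> R := pi_gt0 R.
pose r := Num.sqrt (s / pi).
have r2 : r ^+ 2 = s / pi by rewrite sqr_sqrtr// divr_ge0// ltW.
have r0 : r != 0 by rewrite lt0r_neq0// sqrtr_gt0 divr_gt0.
pose o := Ordinal hk.
have -> : s%:E = c ((r \*: xrow o o) @` ball2 k 1).
  rewrite capacity_scale_xrow// (normalized_capacity_ball hc) -EFinM r2.
  by rewrite divfK// gt_eqF.
apply: (capacity_monotone hs) => _ [z zB <-]; apply: HU.
rewrite /sqnorm (eq_bigr (fun a => r ^+ 2 * sqmod z a)); last first.
  by move=> a _; rewrite sqmod_scale_xrow tperm1 perm1.
rewrite -mulr_sumr r2 mulrA mulrC [pi * _]mulrC divfK ?gt_eqF//.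
by rewrite gtr_pMl//; move: zB; rewrite /ball2 /= expr1n.
Qed.

(** Exchanging the coordinates 0 and j turns the standard cylinder into the one
    over the disc in the [z_j]-plane. *)
Lemma cylinder_capacity_le (R : realType) (k : nat)
    (c : set (Cspace R k) -> \bar R) (j : 'I_k) (s : R) (U : set (Cspace R k)) :
  normalized_capacity c -> 0 < s ->
  (forall z, U z -> pi * sqmod z j < s) -> (c U <= s%:E)%E.
Proof.
move=> hc s0 HU; have hs := normalized_capacity_symplectic hc.
have pi0 : 0 < pi :> R := pi_gt0 R.
pose r := Num.sqrt (s / pi).
have r2 : r ^+ 2 = s / pi by rewrite sqr_sqrtr// divr_ge0// ltW.
have r0 : r != 0 by rewrite lt0r_neq0// sqrtr_gt0 divr_gt0.
pose o := Ordinal (leq_ltn_trans (leq0n j) (ltn_ord j)).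
have -> : s%:E = c ((r \*: xrow o j) @` cylinder k 1).
  rewrite capacity_scale_xrow// (normalized_capacity_cylinder hc) -EFinM r2.
  by rewrite divfK// gt_eqF.
apply: (capacity_monotone hs) => z /HU zs.
exists ((r^-1 \*: xrow o j) z); last exact: scale_xrowK.
move=> a a0; have -> : a = o by exact/val_inj.
rewrite sqmod_scale_xrow tpermL exprVn r2 invf_div expr1n.
by rewrite mulrAC ltr_pdivrMr// mul1r.
Qed.

(** * Convex subsets of the orthant stable under projection to the axes *)

(** What the computation of the capacity uses of [Omega].  Unlike
    [convex_toric], it is inherited by closures. *)
Record axis_convex (R : realType) (k : nat) (A : set 'rV[R]_k) : Prop :=
  AxisConvex {
  axis_convex_orthant : A `<=` orthant ;
  axis_convex0 : A 0 ;
  axis_convex_proj : forall x j, A x -> A (x 0 j *: delta_mx 0 j) ;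
  axis_convex_conv : forall x y t, 0 <= t -> t <= 1 -> A x -> A y ->
    A (t *: x + (1 - t) *: y)
}.

Lemma convex_toric_axis_convex (R : realType) (k : nat) (A : set 'rV[R]_k) :
  convex_toric A -> axis_convex A.
Proof.
case=> -[x0 Ax0] [V _ AV] _ hconv.
have Aorth : A `<=` orthant by rewrite AV; exact: subIsetr.
have conv x y t : 0 <= t -> t <= 1 -> hat A x -> hat A y ->
    hat A (t *: x + (1 - t) *: y).
  move=> t0 t1 /mem_set xA /mem_set yA.
  by have := hconv x y (Itv01 t0 t1) xA yA; rewrite inE.
have absE (x : 'rV[R]_k) : orthant x -> \row_j `|x 0 j| = x.
  by move=> ox; apply/rowP => j; rewrite mxE ger0_norm.
have hatA x : A x -> hat A x.
  by move=> Ax; rewrite /hat /= absE//; exact: Aorth.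
have Ahat x : orthant x -> hat A x -> A x.
  by move=> ox; rewrite /hat /= absE.
have half01 : (0 <= 2^-1 :> R) /\ (2^-1 <= 1 :> R) by split; lra.
(* averaging with a reflected copy of a point kills the reflected coordinates *)
have refl x (P : pred 'I_k) : A x -> A (\row_j if P j then x 0 j else 0).
  move=> Ax; have ox := Aorth _ Ax; apply: Ahat.
    by move=> j; rewrite mxE; case: ifP => // _; exact: ox.
  pose y : 'rV[R]_k := \row_j if P j then x 0 j else - x 0 j.
  have hy : hat A y.
    rewrite /hat /= (_ : \row_j _ = x)//; apply/rowP => j; rewrite !mxE.
    by case: ifP => _; rewrite ?normrN ger0_norm//; exact: ox.
  rewrite (_ : \row_j _ = 2^-1 *: x + (1 - 2^-1) *: y).
    by apply: conv => //; [case: half01..|exact: hatA].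
  by apply/rowP => j; rewrite !mxE; case: ifP => _; lra.
split=> //.
- have := refl _ pred0 Ax0; congr A.
  by apply/rowP => j; rewrite !mxE.
- move=> x j Ax.
  have := refl _ (pred1 j) Ax; congr A; apply/rowP => i; rewrite !mxE /=.
  by have [->|_] := eqVneq i j; rewrite ?mulr1 ?mulr0.
- move=> x y t t0 t1 Ax Ay; apply: Ahat; last by apply: conv => //; exact: hatA.
  move=> j; rewrite !mxE addr_ge0// mulr_ge0 ?subr_ge0//.
    exact: (Aorth _ Ax).
  exact: (Aorth _ Ay).
Qed.

Lemma axis_convex_closure (R : realType) (k : nat) (A : set 'rV[R]_k) :
  axis_convex A -> axis_convex (closure A).
Proof.
move=> [Aorth A0 Aproj Aconv].
have affine (x : 'rV[R]_k) (t : R) :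
    continuous (fun y : 'rV[R]_k => t *: y + x).
  move=> y; apply: continuousD; first exact: scaler_continuous.
  exact: cst_continuous.
split.
- move=> x clx j; rewrite leNgt; apply/negP => xj0.
  have [y [Ay /= yj0]] :=
    clx _ (@coord_continuous _ _ _ 0 j x _ (lt_nbhsl xj0)).
  by move: (Aorth _ Ay j); rewrite leNgt yj0.
- exact: subset_closure.
- move=> x j clx; pose f (y : 'rV[R]_k) : 'rV[R]_k := y 0 j *: delta_mx 0 j.
  apply: (closure_image (f := f) _ _ clx).
    move=> y.
    exact: (continuous_comp (@coord_continuous R 1 k 0 j y)
             (@scalel_continuous R _ (delta_mx 0 j : 'rV[R]_k) _)).
  by move=> y Ay; apply: subset_closure; exact: Aproj.
- move=> x y t t0 t1 clx cly.
  pose f (u : 'rV[R]_k) := (1 - t) *: u + t *: x.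
  rewrite addrC; apply: (closure_image (f := f) _ _ cly); first exact: affine.
  move=> u Au; rewrite /f addrC.
  pose g (w : 'rV[R]_k) := t *: w + (1 - t) *: u.
  apply: (closure_image (f := g) _ _ clx); first exact: affine.
  by move=> w Aw; apply: subset_closure; exact: Aconv.
Qed.

Lemma axis_convex_le (R : realType) (k : nat) (A : set 'rV[R]_k) (x : 'rV[R]_k)
    (s t : R) :
  axis_convex A -> 0 <= s -> s <= t -> A (t *: x) -> A (s *: x).
Proof.
move=> hA s0; rewrite le_eqVlt => /predU1P[<-//|st] At.
have t0 : 0 < t by exact: le_lt_trans st.
rewrite (_ : s *: x = (s / t) *: (t *: x) + (1 - s / t) *: 0).
  apply: (axis_convex_conv hA) => //; last exact: axis_convex0.
    by rewrite divr_ge0// ltW.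
  by rewrite ler_pdivrMr// mul1r ltW.
by rewrite scaler0 addr0 scalerA divfK// gt_eqF.
Qed.

(** When [A] is [axis_convex] and [s >= 0], this says that the simplex
    [{x | 0 <= x_j, x_1 + ... + x_k <= s}] is inscribed in [A]. *)
Definition inscribed (R : realType) (k : nat) (A : set 'rV[R]_k) (s : R) :=
  forall j, A (s *: delta_mx 0 j).

(** With [s] the sum of the coordinates of [x], the point [s x] is the sum of
    the [x_j (s e_j)], and a combination of points of [A] with nonnegative
    weights of sum [s] is [s] times a point of [A]. *)
Lemma axis_convex_simplex (R : realType) (k : nat) (A : set 'rV[R]_k)
    (x : 'rV[R]_k) :
  axis_convex A -> orthant x -> inscribed A (\sum_j x 0 j) -> A x.
Proof.
move=> hA ox; set s := \sum_j x 0 j => sA.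
have s0 : 0 <= s by apply: sumr_ge0 => j _; exact: ox.
have partial (l : seq 'I_k) : exists2 q, A q &
    \sum_(j <- l) x 0 j *: (s *: delta_mx 0 j) = (\sum_(j <- l) x 0 j) *: q.
  elim: l => [|j l [q Aq qE]].
    by exists 0; [exact: axis_convex0|rewrite !big_nil scale0r].
  rewrite !big_cons qE; set w := \sum_(i <- l) x 0 i.
  have w0 : 0 <= w by apply: sumr_ge0 => i _; exact: ox.
  have xj0 := ox j.
  have [xw0|xw0] := eqVneq (x 0 j + w) 0.
    (* all the weights vanish, and any point of A will do *)
    exists 0; first exact: axis_convex0.
    have [-> ->] : x 0 j = 0 /\ w = 0 by split; lra.
    by rewrite !scale0r scaler0 addr0.
  have xw_gt0 : 0 < x 0 j + w by rewrite lt0r xw0 addr_ge0.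
  exists ((x 0 j / (x 0 j + w)) *: (s *: delta_mx 0 j)
          + (1 - x 0 j / (x 0 j + w)) *: q).
    apply: (axis_convex_conv hA) => //; first by rewrite divr_ge0// ltW.
    by rewrite ler_pdivrMr// mul1r lerDl.
  move: (s *: delta_mx 0 j) => p; rewrite scalerDr !scalerA.
  by congr (_ *: _ + _ *: _); field.
(* the weights used so far add up to s over the whole index set *)
have [q Aq] := partial (index_enum 'I_k).
have -> : \sum_j x 0 j *: (s *: delta_mx 0 j) = s *: x.
  rewrite [in RHS](matrix_sum_delta x) big_ord1 scaler_sumr.
  by apply: eq_bigr => j _; rewrite !scalerA mulrC.
rewrite -/s; have [s_eq0 _|s_neq0] := eqVneq s 0.
  have xj0 : forall j, x 0 j = 0.
    move/eqP: s_eq0; rewrite psumr_eq0 => [|j _]; last exact: ox.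
    by move=> /allP xj j; exact/eqP/xj/mem_index_enum.
  rewrite (_ : x = 0); first exact: axis_convex0.
  by apply/rowP => j; rewrite xj0 mxE.
by move=> /(scalerI s_neq0) ->.
Qed.

Lemma inscribed_capacity_ge (R : realType) (k : nat) (hk : (0 < k)%N)
    (A : set 'rV[R]_k) (c : set (Cspace R k) -> \bar R) (s : R) :
  axis_convex A -> normalized_capacity c ->
  0 <= s -> inscribed A s -> (s%:E <= c (toric_domain A))%E.
Proof.
move=> hA hc; rewrite le_eqVlt => /predU1P[<- _|s0 sA].
  exact: (capacity_ge0 (normalized_capacity_symplectic hc)).
apply: (ball_capacity_ge hk) => // z zs.
have pi0 : 0 < pi :> R := pi_gt0 R.
have oz : orthant (moment z).
  by move=> j; rewrite mxE mulr_ge0 ?(ltW pi0)// /sqmod addr_ge0 ?sqr_ge0.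
apply: axis_convex_simplex => // j.
apply: axis_convex_le (sA j) => //; first by apply: sumr_ge0 => i _; exact: oz.
apply: ltW; move: zs; rewrite /sqnorm mulr_sumr.
by under [X in _ -> X < _]eq_bigr do rewrite mxE.
Qed.

(** If [s e_j] is not in [A], the j-th coordinate is smaller than [s] on [A]:
    otherwise the projection to the j-th axis of a point of [A] would be some
    [t e_j] in [A] with [t >= s]. *)
Lemma not_inscribed_capacity_le (R : realType) (k : nat)
    (A : set 'rV[R]_k) (c : set (Cspace R k) -> \bar R) (s : R) :
  axis_convex A -> normalized_capacity c ->
  0 <= s -> ~ inscribed A s -> (c (toric_domain A) <= s%:E)%E.
Proof.
move=> hA hc s_ge0 /existsNP[j sAj].
have s0 : 0 < s.
  rewrite lt0r s_ge0 andbT; apply: contra_not_neq sAj => ->.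
  by rewrite scale0r; exact: axis_convex0.
apply: (@cylinder_capacity_le _ _ _ j) => // z Az.
rewrite ltNge; apply: contra_notN sAj => sz.
apply: axis_convex_le sz _ => //.
by have := axis_convex_proj hA j Az; rewrite mxE.
Qed.

(** * Products *)

Lemma prodRE (R : realType) (n m : nat) (A : set 'rV[R]_n) (B : set 'rV[R]_m) :
  prodR A B = [set x | A (lsubmx x) /\ B (rsubmx x)].
Proof.
apply/seteqP; split=> [_ [a Aa [b Bb <-]]|x [Ax Bx]] /=.
  by rewrite row_mxKl row_mxKr.
by exists (lsubmx x) => //; exists (rsubmx x) => //; rewrite hsubmxK.
Qed.

Lemma prodC_toric_domain (R : realType) (n m : nat)
    (A : set 'rV[R]_n) (B : set 'rV[R]_m) :
  prodC (toric_domain A) (toric_domain B) = toric_domain (prodR A B).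
Proof.
have lmoment (z : Cspace R (n + m)) : lsubmx (moment z) = moment (usubmx z).
  by apply/rowP => j; rewrite !mxE /sqmod !mxE.
have rmoment (z : Cspace R (n + m)) : rsubmx (moment z) = moment (dsubmx z).
  by apply/rowP => j; rewrite !mxE /sqmod !mxE.
rewrite prodRE; apply/seteqP; split=> [_ [a Aa [b Bb <-]]|z].
  by rewrite /toric_domain /= lmoment rmoment col_mxKu col_mxKd.
rewrite /toric_domain /= lmoment rmoment => -[Az Bz].
by exists (usubmx z) => //; exists (dsubmx z) => //; rewrite vsubmxK.
Qed.

Lemma lsubmx_continuous (R : realType) (n m : nat) :
  continuous (lsubmx : 'rV[R]_(n + m) -> 'rV[R]_n).
Proof.
apply: mx_continuous => i j.
rewrite (_ : (fun x => _) = fun x : 'rV[R]_(n + m) => x i (lshift m j)).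
  exact: coord_continuous.
by apply/funext => x; rewrite mxE.
Qed.

Lemma rsubmx_continuous (R : realType) (n m : nat) :
  continuous (rsubmx : 'rV[R]_(n + m) -> 'rV[R]_m).
Proof.
apply: mx_continuous => i j.
rewrite (_ : (fun x => _) = fun x : 'rV[R]_(n + m) => x i (rshift n j)).
  exact: coord_continuous.
by apply/funext => x; rewrite mxE.
Qed.

Lemma row_mx_continuousl (R : realType) (n m : nat) (b : 'rV[R]_m) :
  continuous (fun a : 'rV[R]_n => row_mx a b).
Proof.
apply: mx_continuous => i j; case: (split_ordP j) => l ->.
  rewrite (_ : (fun x => _) = fun x : 'rV[R]_n => x i l).
    exact: coord_continuous.
  by apply/funext => x; rewrite row_mxEl.
rewrite (_ : (fun x => _) = fun _ => b i l); first exact: cst_continuous.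
by apply/funext => x; rewrite row_mxEr.
Qed.

Lemma row_mx_continuousr (R : realType) (n m : nat) (a : 'rV[R]_n) :
  continuous (fun b : 'rV[R]_m => row_mx a b).
Proof.
apply: mx_continuous => i j; case: (split_ordP j) => l ->.
  rewrite (_ : (fun x => _) = fun _ => a i l); first exact: cst_continuous.
  by apply/funext => x; rewrite row_mxEl.
rewrite (_ : (fun x => _) = fun x : 'rV[R]_m => x i l).
  exact: coord_continuous.
by apply/funext => x; rewrite row_mxEr.
Qed.

Lemma closure_prodR (R : realType) (n m : nat)
    (A : set 'rV[R]_n) (B : set 'rV[R]_m) :
  prodR (closure A) (closure B) = closure (prodR A B).
Proof.
apply/seteqP; split=> [_ [a Aa [b Bb <-]]|x clx].
  apply: (closure_image _ _ Bb); first exact: row_mx_continuousr.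
  move=> v Bv; pose f (u : 'rV[R]_n) := row_mx u v.
  apply: (closure_image (f := f) _ _ Aa).
    exact: row_mx_continuousl.
  by move=> u Au; apply: subset_closure; exists u => //; exists v.
rewrite prodRE; split.
  apply: (closure_image _ _ clx); first exact: lsubmx_continuous.
  by move=> y; rewrite prodRE => -[Ax _]; exact: subset_closure.
apply: (closure_image _ _ clx); first exact: rsubmx_continuous.
by move=> y; rewrite prodRE => -[_ Bx]; exact: subset_closure.
Qed.

Lemma norm_row_mx (R : realType) (n m : nat) (a : 'rV[R]_n) (b : 'rV[R]_m) :
  `|row_mx a b| <= Num.max `|a| `|b|.
Proof.
have coord_le k (v : 'rV[R]_k) (j : 'I_k) : `|v 0 j| <= `|v|.
  rewrite [leRHS]/Num.norm /= mx_normrE.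
  by apply/bigmax_geP; right; exists (0, j).
rewrite [leLHS]/Num.norm /= mx_normrE; apply: bigmax_le.
  by rewrite le_max normr_ge0.
move=> [i j] _ /=; rewrite (ord1 i); case: (split_ordP j) => l ->.
  by rewrite row_mxEl le_max coord_le.
by rewrite row_mxEr le_max coord_le orbT.
Qed.

Lemma convex_toric_prodR (R : realType) (n m : nat)
    (A : set 'rV[R]_n) (B : set 'rV[R]_m) :
  convex_toric A -> convex_toric B -> convex_toric (prodR A B).
Proof.
case=> -[a Aa] [V oV AV] bA cA [[b Bb] [Q oQ BQ] bB cB]; split.
- by exists (row_mx a b); exists a => //; exists b.
- exists (lsubmx @^-1` V `&` rsubmx @^-1` Q).
    apply: openI; apply: open_comp => // x _.
      exact: lsubmx_continuous.
    exact: rsubmx_continuous.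
  rewrite prodRE AV BQ; apply/seteqP; split=> x /=.
    move=> [[Ox o1] [Qx o2]]; split=> // j.
    by case: (split_ordP j) => l ->; [have := o1 l|have := o2 l]; rewrite mxE.
  by move=> [[Ox Qx] ox]; do 2!split=> //; move=> j; rewrite mxE; exact: ox.
- have [M1 [_ hM1]] := bA; have [M2 [_ hM2]] := bB.
  exists (Num.max M1 M2); split; first exact: num_real.
  move=> M; rewrite gt_max => /andP[M1M M2M] _ [u Au [v Bv <-]].
  apply: le_trans (norm_row_mx _ _) _; rewrite ge_max.
  by apply/andP; split; [exact: hM1 Au|exact: hM2 Bv].
- have lrow (x : 'rV[R]_(n + m)) :
      lsubmx (\row_j `|x 0 j|) = \row_j `|lsubmx x 0 j|.
    by apply/rowP => j; rewrite !mxE.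
  have rrow (x : 'rV[R]_(n + m)) :
      rsubmx (\row_j `|x 0 j|) = \row_j `|rsubmx x 0 j|.
    by apply/rowP => j; rewrite !mxE.
  have hatE : hat (prodR A B) = [set x | hat A (lsubmx x) /\ hat B (rsubmx x)].
    by rewrite prodRE /hat; apply/seteqP; split=> x /=; rewrite lrow rrow.
  move=> x y t; rewrite !inE hatE => -[Ax Bx] [Ay By] /=; split.
    have := cA (lsubmx x) (lsubmx y) t (mem_set Ax) (mem_set Ay).
    rewrite inE; congr (hat A _).
    by apply/rowP => j; rewrite !mxE.
  have := cB (rsubmx x) (rsubmx y) t (mem_set Bx) (mem_set By).
  rewrite inE; congr (hat B _).
  by apply/rowP => j; rewrite !mxE.
Qed.

(** The vertex of index j of the simplex in the product has its nonzero
    coordinate in one factor, and its component in the other factor is 0. *)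
Lemma inscribed_prodR (R : realType) (n m : nat)
    (A : set 'rV[R]_n) (B : set 'rV[R]_m) (s : R) :
  A 0 -> B 0 ->
  inscribed (prodR A B) s <-> inscribed A s /\ inscribed B s.
Proof.
move=> A0 B0.
have ll j : lsubmx (s *: delta_mx 0 (lshift m j) : 'rV[R]_(n + m))
    = s *: delta_mx 0 j.
  by apply/rowP => i; rewrite !mxE (inj_eq (@lshift_inj _ _)).
have lr j : rsubmx (s *: delta_mx 0 (lshift m j) : 'rV[R]_(n + m)) = 0.
  by apply/rowP => i; rewrite !mxE eq_rlshift mulr0.
have rl j : lsubmx (s *: delta_mx 0 (rshift n j) : 'rV[R]_(n + m)) = 0.
  by apply/rowP => i; rewrite !mxE eq_lrshift mulr0.
have rr j : rsubmx (s *: delta_mx 0 (rshift n j) : 'rV[R]_(n + m))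
    = s *: delta_mx 0 j.
  by apply/rowP => i; rewrite !mxE (inj_eq (@rshift_inj _ _)).
rewrite prodRE; split=> [sAB|[sA sB] j /=].
  by split=> j; [have [] := sAB (lshift m j)|have [] := sAB (rshift n j)];
    rewrite ?ll ?lr ?rl ?rr.
by case: (split_ordP j) => i ->; rewrite ?ll ?lr ?rl ?rr; split.
Qed.

(** * The capacity of a product *)

(** A real number strictly between two such separators of [I] from its
    complement could belong neither to [I] nor to its complement.  With this
    characterization in place of the supremum of the admissible [s], finiteness
    never has to be discussed. *)
Lemma ereal_cut_unique (R : realType) (I : set R) (v w : \bar R) :
  (0 <= v)%E -> (0 <= w)%E ->
  (forall s, 0 <= s -> I s -> (s%:E <= v)%E) ->
  (forall s, 0 <= s -> ~ I s -> (v <= s%:E)%E) ->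
  (forall s, 0 <= s -> I s -> (s%:E <= w)%E) ->
  (forall s, 0 <= s -> ~ I s -> (w <= s%:E)%E) -> v = w.
Proof.
have between (a b : \bar R) : (0 <= a)%E -> (a < b)%E ->
    exists s : R, [/\ 0 <= s, (a < s%:E)%E & (s%:E < b)%E].
  case: a => [a||]//; case: b => [b||]//; rewrite ?lee_fin ?lte_fin.
    move=> a0 ab; exists ((a + b) / 2); rewrite !lte_fin; split; lra.
  by move=> a0 _; exists (a + 1); rewrite lte_fin ltry; split=> //; lra.
have half (a b : \bar R) : (0 <= a)%E ->
    (forall s, 0 <= s -> I s -> (s%:E <= a)%E) ->
    (forall s, 0 <= s -> ~ I s -> (b <= s%:E)%E) -> (b <= a)%E.
  move=> a0 Ia Ib; rewrite leNgt; apply/negP.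
  move=> /(between _ _ a0)[s [s0 as_ sb]].
  have [Is|Is] := pselect (I s).
    by move: as_; rewrite ltNge Ia.
  by move: sb; rewrite ltNge Ib.
by move=> v0 w0 *; apply/eqP; rewrite eq_le; apply/andP; split; exact: half.
Qed.

(** Both sides separate the [s] that are [inscribed] in the product from the
    others: the left one by the sandwich between balls and cylinders in the
    product, the right one by the sandwich in each factor. *)
Lemma capacity_prodC (R : realType) (n m : nat)
    (hn : (0 < n)%N) (hm : (0 < m)%N)
    (A : set 'rV[R]_n) (B : set 'rV[R]_m)
    (c : set (Cspace R (n + m)) -> \bar R)
    (c1 : set (Cspace R n) -> \bar R) (c2 : set (Cspace R m) -> \bar R) :
  axis_convex A -> axis_convex B -> axis_convex (prodR A B) ->
  normalized_capacity c -> normalized_capacity c1 -> normalized_capacity c2 ->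
  c (prodC (toric_domain A) (toric_domain B))
    = Order.min (c1 (toric_domain A)) (c2 (toric_domain B)).
Proof.
move=> hA hB hAB hc hc1 hc2; rewrite prodC_toric_domain.
have inscribedE s := inscribed_prodR s (axis_convex0 hA) (axis_convex0 hB).
apply: (@ereal_cut_unique _ (inscribed (prodR A B))).
- exact: (capacity_ge0 (normalized_capacity_symplectic hc)).
- rewrite le_min (capacity_ge0 (normalized_capacity_symplectic hc1)).
  by rewrite (capacity_ge0 (normalized_capacity_symplectic hc2)).
- by move=> s s0; apply: inscribed_capacity_ge => //; rewrite addn_gt0 hn.
- by move=> s s0; exact: not_inscribed_capacity_le.
- move=> s s0 /inscribedE[sA sB].
  by rewrite le_min !inscribed_capacity_ge.
- move=> s s0 sAB; rewrite ge_min; apply/orP.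
  have [sA|sA] := pselect (inscribed A s); last first.
    by left; exact: not_inscribed_capacity_le.
  right; apply: not_inscribed_capacity_le => // sB.
  by apply: sAB; exact/inscribedE.
Qed.

Unset Implicit Arguments.
Set Strict Implicit.

Theorem corollary1p5 (R : realType) (n m : nat) (hn : (0 < n)%N) (hm : (0 < m)%N)
  (Omega1 : set 'rV[R]_n) (Omega2 : set 'rV[R]_m)
  (hOmega1 : convex_toric Omega1) (hOmega2 : convex_toric Omega2) :
  [/\ convex_toric (prodR Omega1 Omega2),
      prodC (toric_domain Omega1) (toric_domain Omega2)
        = toric_domain (prodR Omega1 Omega2)
    & forall (c : set (Cspace R (n + m)) -> \bar R)
             (c1 : set (Cspace R n) -> \bar R)
             (c2 : set (Cspace R m) -> \bar R),
        normalized_capacity c -> normalized_capacity c1 ->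
        normalized_capacity c2 ->
        c (prodC (toric_domain Omega1) (toric_domain Omega2))
          = Order.min (c1 (toric_domain Omega1)) (c2 (toric_domain Omega2))]
  /\
  [/\ prodR (closure Omega1) (closure Omega2)
        = closure (prodR Omega1 Omega2),
      prodC (toric_domain (closure Omega1)) (toric_domain (closure Omega2))
        = toric_domain (prodR (closure Omega1) (closure Omega2))
    & forall (c : set (Cspace R (n + m)) -> \bar R)
             (c1 : set (Cspace R n) -> \bar R)
             (c2 : set (Cspace R m) -> \bar R),
        normalized_capacity c -> normalized_capacity c1 ->
        normalized_capacity c2 ->
        c (prodC (toric_domain (closure Omega1)) (toric_domain (closure Omega2)))
          = Order.min (c1 (toric_domain (closure Omega1)))
                      (c2 (toric_domain (closure Omega2)))].
Proof.
have hAB := convex_toric_prodR hOmega1 hOmega2.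
have h1 := convex_toric_axis_convex hOmega1.
have h2 := convex_toric_axis_convex hOmega2.
have h12 := convex_toric_axis_convex hAB.
split; split.
- exact: hAB.
- exact: prodC_toric_domain.
- by move=> c c1 c2; exact: capacity_prodC.
- exact: closure_prodR.
- exact: prodC_toric_domain.
- move=> c c1 c2; apply: capacity_prodC => //; try exact: axis_convex_closure.
  by rewrite closure_prodR; exact: axis_convex_closure.
Qed.
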